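(* Let $d,K\in\mathbb{N}$, $\lambda>0$, $c\geqslant1$. The Hermite-HDMR approximation up to order $K$, that is, $$\sum_{k=1}^K\sum_{m\in\Gamma^k(d,c,\lambda)}\alpha_m(f)H_{m,\lambda}(x-a),$$ is a truncated HDMR expansion of not more than order $u$ if $$(1+c)^{u+1}>\frac{K+1}{(2\lambda^2)^d},\qquad 1\leqslant u\leqslant d.$$ Hence the number of degrees of freedom of this approximation is $$O\left(\frac{K+1}{(2\lambda^2)^d}\left(1+\log\left(1+\frac{K+1}{(2\lambda^2)^d}\right)\right)^{u-1}\right).$$
   Context: $\mathbb{N}=\{1,2,\dots\}$, $\mathbb{N}_0=\mathbb{N}\cup\{0\}$; $u$ is an integer. For $k\in\mathbb{N}$: $\Gamma^k(d,c,\lambda)=\{m\in\mathbb{N}_0^d:\ k\leqslant(2\lambda^2)^d\prod_{j=1}^d(m_j+c)<k+1\}$. Here $a\in\mathbb{R}^d$, $f\in\mathcal{L}_2(\mathbb{R}^d)$ is a real function with $\int_{\mathbb{R}^d}|f(x)|^2e^{-\lambda^2\|x-a\|^2}dx<\infty$, $\phi_j(t)=e^{t^2}\frac{d^j}{dt^j}e^{-t^2}$, $H_{m,\lambda}(x-a)=\sqrt{\frac{\lambda^d}{\pi^{d/2}\prod_{i=1}^d(2m_i)!!}}\;\prod_{i=1}^d\phi_{m_i}(\lambda(x_i-a_i))$ with $(2n)!!=2\cdot4\cdots2n$ and $0!!=1$, and $\alpha_m(f)=\int_{\mathbb{R}^d}H_{m,\lambda}(x-a)f(x)e^{-\lambda^2\|x-a\|^2}dx$.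 The HDMR decomposition groups the indices $m\in\Gamma^k(d,c,\lambda)$ according to the set $\{j_1,\dots,j_l\}\subset\{1,\dots,d\}$ of positions of their nonzero components; the term with index $m$ depends only on the variables $x_j$ with $m_j\neq0$. A truncated HDMR expansion of not more than order $u$ contains only terms whose index $m$ has at most $u$ nonzero components. The number of degrees of freedom is the number of indices $m$ occurring in the sum. *)

(* Defs.v *)
From HB Require Import structures.
From mathcomp Require Export all_boot all_order all_algebra.
From mathcomp Require Export finmap.
From mathcomp Require Export all_classical all_reals all_analysis.

Set Implicit Arguments.
Unset Strict Implicit.
Unset Printing Implicit Defensive.
Import Order.TTheory GRing.Theory Num.Theory.
Export numFieldNormedType.Exports.

Local Open Scope classical_set_scope.
Local Open Scope ring_scope.

Notation Rd R d := (d.-tuple (measurableTypeR R)).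

(* The library has the Borel sigma-algebra of [R^d] but no Lebesgue measure on
   it; the latter is built here by adding one coordinate at a time. *)
Section add_coordinate.
Local Open Scope ereal_scope.
Context (R : realType) (d : nat) (mu : {measure set (Rd R d) -> \bar R}).

Definition cons_Rd (z : Rd R d * measurableTypeR R) : Rd R d.+1 :=
  [tuple of z.2 :: z.1].

Lemma measurable_cons_Rd : measurable_fun setT cons_Rd.
Proof.
by apply: (@measurable_cons _ _ _ _ snd d fst);
  [exact: measurable_snd|exact: measurable_fst].
Qed.

Definition add_lebesgue : set (Rd R d.+1) -> \bar R :=
  pushforward (mu \x @lebesgue_measure R) cons_Rd.

Let add_lebesgue0 : add_lebesgue set0 = 0.
Proof. by rewrite /add_lebesgue /pushforward preimage_set0 measure0. Qed.

Let add_lebesgue_ge0 A : 0 <= add_lebesgue A.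
Proof. by rewrite /add_lebesgue /pushforward measure_ge0. Qed.

Let add_lebesgue_sigma_additive : semi_sigma_additive add_lebesgue.
Proof.
move=> F mF tF mUF.
have mpre A : measurable A -> measurable (cons_Rd @^-1` A).
  by move=> mA; rewrite -[X in measurable X]setTI; exact: measurable_cons_Rd.
rewrite /add_lebesgue /pushforward preimage_bigcup.
apply: measure_semi_sigma_additive.
- by move=> n; exact: mpre.
- apply/trivIsetP => /= i j _ _ ij; rewrite -preimage_setI.
  by move/trivIsetP : tF => /(_ _ _ _ _ ij) ->//; rewrite preimage_set0.
- by rewrite -preimage_bigcup; exact: mpre.
Qed.

HB.instance Definition _ := isMeasure.Build _ _ _ add_lebesgue
  add_lebesgue0 add_lebesgue_ge0 add_lebesgue_sigma_additive.

End add_coordinate.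

Fixpoint lebesgue_Rd (R : realType) (d : nat) :
    {measure set (Rd R d) -> \bar R} :=
  match d return {measure set (Rd R d) -> \bar R} with
  | 0 => @dirac _ (Rd R 0) [tuple] R
  | n.+1 => add_lebesgue (lebesgue_Rd R n)
  end.

Section hermite.
Context (R : realType).

Definition phi (j : nat) (t : R) : R :=
  expR (t ^+ 2) * derive1n j (fun s : R => expR (- (s ^+ 2))) t.

(* [(2 n)!! = 2 * 4 * ... * 2 n], with [0!! = 1]. *)
Definition even_double_fact (n : nat) : nat :=
  (\prod_(1 <= i < n.+1) (2 * i))%N.

Context (d : nat) (lambda : R) (a : Rd R d).

Definition sqdist (x : Rd R d) : R :=
  \sum_(i < d) (tnth x i - tnth a i) ^+ 2.

Definition weight (x : Rd R d) : R := expR (- (lambda ^+ 2 * sqdist x)).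

(* [hermite m x] stands for [H_{m,lambda}(x - a)]. *)
Definition hermite (m : {ffun 'I_d -> nat}) (x : Rd R d) : R :=
  Num.sqrt (lambda ^+ d /
            (pi `^ (d%:R / 2) * \prod_(i < d) (even_double_fact (m i))%:R)) *
  \prod_(i < d) phi (m i) (lambda * (tnth x i - tnth a i)).

Definition alpha (f : Rd R d -> R) (m : {ffun 'I_d -> nat}) : R :=
  \int[lebesgue_Rd R d]_x (hermite m x * f x * weight x).

End hermite.

Definition Gamma (R : realType) (d : nat) (c lambda : R) (k : nat) :
    set {ffun 'I_d -> nat} :=
  [set m | k%:R <= (2 * lambda ^+ 2) ^+ d * \prod_(j < d) ((m j)%:R + c)
           < (k.+1)%:R].

Definition approx_indices (R : realType) (d : nat) (c lambda : R) (K : nat) :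
    set {ffun 'I_d -> nat} :=
  [set m | exists2 k, (1 <= k <= K)%N & Gamma c lambda k m].

(* [\sum_(m \in A)] over a set [A] is meaningful for finite support only; the
   finiteness of the index set is part of [truncated_HDMR] below. *)
Definition hermite_hdmr (R : realType) (d : nat) (c lambda : R) (a : Rd R d)
    (f : Rd R d -> R) (K : nat) (x : Rd R d) : R :=
  \sum_(1 <= k < K.+1) \sum_(m \in @Gamma R d c lambda k)
     alpha lambda a f m * hermite lambda a m x.

Section hdmr.
Context (R : realType) (d : nat).

Definition nzpos (m : {ffun 'I_d -> nat}) : {set 'I_d} :=
  finset (fun j => m j != 0%N).

Definition depends_only_on (S : {set 'I_d}) (g : Rd R d -> R) : Prop :=
  forall x y, (forall j, j \in S -> tnth x j = tnth y j) -> g x = g y.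

(* The HDMR component attached to the variables [x_j], [j \in S], of the sum
   of the terms [t m], [m] in [L]. *)
Definition hdmr_component (L : set {ffun 'I_d -> nat})
    (t : {ffun 'I_d -> nat} -> Rd R d -> R) (S : {set 'I_d}) (x : Rd R d) : R :=
  \sum_(m \in L `&` [set m | nzpos m = S]) t m x.

(* [g], presented as the sum of the terms [t m] over the indices [m] in [L],
   is a truncated HDMR expansion of not more than order [u]. *)
Definition truncated_HDMR (u : nat) (L : set {ffun 'I_d -> nat})
    (t : {ffun 'I_d -> nat} -> Rd R d -> R) (g : Rd R d -> R) : Prop :=
  [/\ finite_set L,
      forall m, L m -> depends_only_on (nzpos m) (t m),
      forall m, L m -> (#|nzpos m| <= u)%N &
      forall x, g x =
        \sum_(S : {set 'I_d} | (#|S| <= u)%N) hdmr_component L t S x].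

End hdmr.

(* Meaningful for finite [L] only: [fset_set L] is empty otherwise. *)
Definition degrees_of_freedom (d : nat) (L : set {ffun 'I_d -> nat}) : nat :=
  #|` fset_set L|.

(* Main.v *)
Require Import Defs.
Import Order.TTheory GRing.Theory Num.Theory.

Set Implicit Arguments.
Unset Strict Implicit.
Unset Printing Implicit Defensive.

Local Open Scope classical_set_scope.
Local Open Scope ring_scope.

(** Since [c >= 1], an index [m] of the approximation with [s] nonzero
components satisfies [(1 + c) ^ s <= \prod_j (m_j + c) < T], where
[T = (K + 1) / (2 lambda^2)^d]; this gives [s <= u]. Moreover
[\prod_j (m_j + 1) <= T], so that for a fixed set of positions of the nonzero
components the number of indices is at most the number of [s]-tuples of
positive integers with product at most [T]. Choosing the first entry [n] first,
this number satisfies [N_(s+1)(T) = \sum_(n <= T) N_s(T / n)], and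
[N_s(T) <= T (1 + log T)^(s-1)] follows by comparing the harmonic sum with the
logarithm. *)

(** * Harmonic sums and sequences of bounded product *)

(* For [N = 0] the bound relies on [ln 0 = 0]. *)
Lemma harmonic_sum_le_ln (R : realType) (N : nat) :
  \sum_(1 <= n < N.+1) (n%:R^-1 : R) <= 1 + ln N%:R.
Proof.
elim: N => [|N IHN]; first by rewrite big_geq// ln0// addr0.
rewrite big_nat_recr//=.
have [->|N0] := posnP N; first by rewrite big_geq// add0r invr1 ln1 addr0.
apply: (le_trans (lerD IHN (lexx _))); rewrite -addrA lerD2l -lerBrDr.
have NS0 : 0 < N.+1%:R :> R by rewrite ltr0n.
have N0R : 0 < N%:R :> R by rewrite ltr0n.
(* Writing [N = (N + 1) (1 - 1 / (N + 1))] reduces the claim to [ln (1 + x) <= x] at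
   [x = - 1 / (N + 1)]. *)
have -> : ln N%:R = ln N.+1%:R + ln (1 + - N.+1%:R^-1) :> R.
  rewrite -lnM ?posrE//; last by rewrite subr_gt0 invf_lt1// ltr1n.
  by rewrite mulrDr mulr1 mulrN mulfV ?gt_eqF// -natr1 addrK.
by rewrite lerD2l le_ln1Dx// ltrN2 invf_lt1// ltr1n.
Qed.

(** Enumerates the [s]-tuples of positive integers with product at most [X >= 1]. Integer division
    loses nothing here: for [n >= 1], [n * p <= X] iff [p <= X %/ n]. *)
Fixpoint bounded_prod_seqs (s X : nat) : seq (seq nat) :=
  if s is s'.+1 then
    [seq n :: t | n <- iota 1 X, t <- bounded_prod_seqs s' (X %/ n)]
  else [:: [::]].

Lemma mem_bounded_prod_seqs (t : seq nat) (X : nat) :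
  all (leq 1) t -> (\prod_(n <- t) n <= X)%N ->
  t \in bounded_prod_seqs (size t) X.
Proof.
elim: t X => [//|n t IHt] X /= /andP[n0 t0]; rewrite big_cons => nX.
have P0 : (0 < \prod_(i <- t) i)%N.
  by rewrite big_seq; apply: prodn_cond_gt0 => i; exact: (allP t0).
apply/allpairsPdep; exists n, t; split => //.
- by rewrite mem_iota n0 add1n ltnS (leq_trans _ nX)// leq_pmulr.
- by apply: IHt => //; rewrite leq_divRL// mulnC.
Qed.

(** [T] stays fixed in the induction while [X] shrinks to [X %/ n]; the logarithmic factor is then
    common to all [n], and the remaining harmonic sum supplies one more such factor. *)
Lemma size_bounded_prod_seqs (R : realType) (s X : nat) (T : R) :
  X%:R <= T ->
  (size (bounded_prod_seqs s.+1 X))%:R <= X%:R * (1 + ln (1 + T)) ^+ s.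
Proof.
elim: s X => [|s IHs] X XT.
  rewrite expr0 mulr1 ler_nat size_allpairs_dep.
  by rewrite sumnE big_map sum1_size size_iota.
have T0 : 0 <= T by rewrite (le_trans _ XT).
have H0 : 0 <= 1 + ln (1 + T) by rewrite addr_ge0// ln_ge0// lerDl.
rewrite [bounded_prod_seqs _ _]/= -/(bounded_prod_seqs s.+1) size_allpairs_dep.
rewrite sumnE big_map natr_sum.
have quot n : (X %/ n)%:R <= X%:R * n%:R^-1 :> R.
  have [->|n0] := posnP n; first by rewrite divn0 invr0 mulr0.
  by rewrite ler_pdivlMr ?ltr0n// -natrM ler_nat leq_divM.
apply: (@le_trans _ _
  (\sum_(n <- iota 1 X) X%:R * n%:R^-1 * (1 + ln (1 + T)) ^+ s)).
  apply: ler_sum => n _; apply: (le_trans (IHs _ _)).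
    by rewrite (le_trans _ XT)// ler_nat leq_div.
  by rewrite ler_wpM2r// exprn_ge0.
rewrite -mulr_suml -mulr_sumr exprS mulrA ler_wpM2r ?exprn_ge0//.
rewrite ler_wpM2l//.
have := harmonic_sum_le_ln R X; rewrite /index_iota subn1 /= => /le_trans; apply.
rewrite lerD2l; have [->|X0] := posnP X; first by rewrite ln0// ln_ge0// lerDl.
by rewrite ler_ln ?posrE ?ltr0n// ?ltr_pwDl// (le_trans XT)// lerDr.
Qed.

(** * Variables of the Hermite terms, and sums over fibers *)

Lemma phi0 (R : realType) (t : R) : phi 0 t = 1.
Proof. by rewrite /phi derive1n0 -expRD subrr expR0. Qed.

(** A zero component of [m] contributes the constant factor [phi 0 = 1]. *)
Lemma hermite_depends_only_on (R : realType) (d : nat) (lambda : R)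
    (a : Rd R d) (m : {ffun 'I_d -> nat}) :
  depends_only_on (nzpos m) (hermite lambda a m).
Proof.
move=> x y xy; rewrite /hermite; congr (_ * _); apply: eq_bigr => i _.
have [->|mi0] := eqVneq (m i) 0%N; first by rewrite !phi0.
by rewrite xy// inE.
Qed.

(** Serves for two groupings of the same index set: by the level [k], and by the set of positions of
    the nonzero components. *)
Lemma fsum_fibers (V : nmodType) (T : choiceType) (J : eqType) (L : set T)
    (g : T -> J) (r : seq J) (F : T -> V) :
  finite_set L -> uniq r -> (forall m, L m -> g m \in r) ->
  \sum_(m \in L) F m = \sum_(j <- r) \sum_(m \in L `&` [set m | g m = j]) F m.
Proof.
move=> finL ur Lr.
transitivity (\sum_(j <- r) \sum_(m <- fset_set L)
    if m \in [set m | g m = j] then F m else 0); last first.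
  by apply: eq_bigr => j _; rewrite fsbig_mkcondr fsbig_finite.
rewrite exchange_big/= fsbig_finite//.
apply: eq_big_seq => m; rewrite in_fset_set// inE => Lm.
rewrite (bigD1_seq (g m)) ?Lr//= big1 ?addr0; first by rewrite ifT// inE.
by move=> j /eqP gj; rewrite ifF//; apply/negbTE; rewrite notin_setE => /esym.
Qed.

(** * Bounds on multi-indices and their enumeration *)

Lemma prod_addr_gt0 (R : realType) (d : nat) (c : R) (m : {ffun 'I_d -> nat}) :
  1 <= c -> 0 < \prod_(j < d) ((m j)%:R + c).
Proof. by move=> c1; apply: prodr_gt0 => j _; rewrite ltr_wpDl// (lt_le_trans ltr01). Qed.

(** Each factor is at least [c >= 1], and at least [1 + c] where the component is nonzero. *)
Lemma prodr_ge_exp_nzpos (R : realType) (d : nat) (c : R)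
    (m : {ffun 'I_d -> nat}) :
  1 <= c -> (1 + c) ^+ #|nzpos m| <= \prod_(j < d) ((m j)%:R + c).
Proof.
move=> c1; rewrite -prodr_const big_mkcond/=; apply: ler_prod => j _.
rewrite inE; case: eqVneq => [->|mj0] /=; first by rewrite ler01 add0r.
by rewrite addr_ge0 ?(le_trans ler01)//= lerD2r ler1n lt0n.
Qed.

(* Inverse of [m |-> (nzpos m, [seq (m j).+1 | j <- enum (nzpos m)])]; entries
   outside of [A] get the default [1.-1 = 0]. *)
Definition index_of_seq (d : nat) (A : {set 'I_d}) (t : seq nat) :
    {ffun 'I_d -> nat} := [ffun j => (nth 1%N t (index j (enum A))).-1].

Lemma index_of_seqK (d : nat) (m : {ffun 'I_d -> nat}) :
  index_of_seq (nzpos m) [seq (m j).+1 | j <- enum (nzpos m)] = m.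
Proof.
apply/ffunP => j; rewrite ffunE; case: (boolP (j \in enum (nzpos m))) => jS.
  by rewrite (nth_map j) ?index_mem// nth_index.
rewrite nth_default; last by rewrite size_map leqNgt index_mem.
by move: jS; rewrite mem_enum inE negbK => /eqP ->.
Qed.

(** The entries of [t] stand for [m j + 1]. An entry [1] yields a zero component inside [A], so an
    index may occur several times; this is harmless for an upper bound on the count. *)
Definition bounded_indices (d u X : nat) : seq {ffun 'I_d -> nat} :=
  [seq index_of_seq A t | A <- [seq A : {set 'I_d} <- enum {set 'I_d} | (#|A| <= u)%N],
                          t <- bounded_prod_seqs #|A| X].

Lemma mem_bounded_indices (d u X : nat) (m : {ffun 'I_d -> nat}) :
  (#|nzpos m| <= u)%N -> (\prod_(j < d) (m j).+1 <= X)%N ->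
  m \in bounded_indices d u X.
Proof.
move=> mu mX; apply/allpairsPdep.
exists (nzpos m), [seq (m j).+1 | j <- enum (nzpos m)].
rewrite mem_filter mu mem_enum inE index_of_seqK; split => //.
set t := map _ _; have <- : size t = #|nzpos m| by rewrite size_map -cardE.
apply: mem_bounded_prod_seqs; first by apply/allP => _ /mapP[j _ ->].
(* Extending the product to all positions only adds factors [(m j).+1 >= 1]. *)
rewrite big_map big_enum/= (leq_trans _ mX)// big_mkcond leq_prod// => j _.
by case: ifP.
Qed.

(** Each set [A] contributes at most the same bound: a nonempty one has exponent [#|A| - 1 <= u - 1]
    on a factor that is at least [1]. *)
Lemma size_bounded_indices (R : realType) (d u X : nat) (T : R) :
  (0 < u)%N -> (0 < X)%N -> X%:R <= T ->
  (size (bounded_indices d u X))%:R <=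
    #|{set 'I_d}|%:R * (T * (1 + ln (1 + T)) ^+ u.-1).
Proof.
move=> u0 X0 XT; have T0 : 0 <= T by rewrite (le_trans _ XT).
have H1 : 1 <= 1 + ln (1 + T) by rewrite lerDl ln_ge0// lerDl.
rewrite size_allpairs_dep sumnE big_map natr_sum big_filter.
rewrite [leRHS]mulrC.
have -> : (T * (1 + ln (1 + T)) ^+ u.-1) * #|{set 'I_d}|%:R =
    \sum_(A <- enum {set 'I_d}) (T * (1 + ln (1 + T)) ^+ u.-1).
  by rewrite big_enum/= sumr_const mulr_natr.
rewrite big_mkcond; apply: ler_sum => S _; case: ifPn => [Su|_]; last first.
  by rewrite mulr_ge0// exprn_ge0// (le_trans ler01).
(* The empty set contributes one sequence, and [1 <= X <= T]. *)
case: #|S| Su => [_|s su].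
  rewrite (@le_trans _ _ X%:R) ?ler_nat// (le_trans XT)// ler_peMr//.
  exact: exprn_ege1.
apply: (le_trans (size_bounded_prod_seqs s XT)).
by rewrite ler_pM// ?exprn_ge0 ?(le_trans ler01)// ler_weXn2l// -ltnS prednK.
Qed.

(** * The index set of the approximation *)

Section approximation.
Context (R : realType) (d K : nat) (lambda c : R).
Hypotheses (lambda_gt0 : 0 < lambda) (c_ge1 : 1 <= c).

Let P (m : {ffun 'I_d -> nat}) : R :=
  (2 * lambda ^+ 2) ^+ d * \prod_(j < d) ((m j)%:R + c).
Let T : R := K.+1%:R / (2 * lambda ^+ 2) ^+ d.

Let scale_gt0 : 0 < (2 * lambda ^+ 2) ^+ d.
Proof. by rewrite exprn_gt0// mulr_gt0// exprn_gt0. Qed.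

Let P_ge0 m : 0 <= P m.
Proof. by rewrite mulr_ge0 ?ltW// prod_addr_gt0. Qed.

(** The sets [Gamma] are the level sets of the integer part of [P]; hence they are disjoint and the
    double sum is a sum over fibers. *)
Lemma Gamma_truncn k m : Gamma c lambda k m <-> Num.truncn (P m) = k.
Proof. by rewrite (rwP eqP) truncn_eq. Qed.

Lemma approx_indices_prod_lt (m : {ffun 'I_d -> nat}) :
  approx_indices c lambda K m -> \prod_(j < d) ((m j)%:R + c) < T.
Proof.
move=> [k /andP[_ kK] /andP[_ Pk]]; rewrite ltr_pdivlMr// mulrC.
by rewrite (lt_le_trans Pk)// ler_nat.
Qed.

Lemma approx_indices_Gamma k : (1 <= k <= K)%N ->
  approx_indices c lambda K `&` [set m | Num.truncn (P m) = k] =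
    @Gamma R d c lambda k.
Proof.
move=> kK; apply/seteqP; split=> [m [_ /Gamma_truncn//]|m Gm].
by split; [exists k|exact/Gamma_truncn].
Qed.

Context (u : nat).
Hypotheses (u_gt0 : (0 < u)%N) (T_lt : T < (1 + c) ^+ u.+1).

Lemma approx_indices_nzpos_le (m : {ffun 'I_d -> nat}) :
  approx_indices c lambda K m -> (#|nzpos m| <= u)%N.
Proof.
move=> /approx_indices_prod_lt mT; rewrite -ltnS.
rewrite -(@ltr_eXn2l _ (1 + c)); last by rewrite ltrDl (lt_le_trans ltr01).
by rewrite (le_lt_trans (prodr_ge_exp_nzpos m c_ge1))// (lt_trans mT).
Qed.

(** Since [c >= 1], [m j + 1 <= m j + c]; the product of the left sides is an integer, so [T] may be
    truncated. *)
Lemma approx_indices_prod_le (m : {ffun 'I_d -> nat}) :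
  approx_indices c lambda K m -> (\prod_(j < d) (m j).+1 <= Num.truncn T)%N.
Proof.
move=> /approx_indices_prod_lt mT.
have T0 : 0 <= T by rewrite divr_ge0 ?ltW.
rewrite truncn_ge_nat// (le_trans _ (ltW mT))// natr_prod.
by apply: ler_prod => j _; rewrite ler0n/= -natr1 lerD2l.
Qed.

Lemma approx_indices_sub :
  approx_indices c lambda K `<=` [set` bounded_indices d u (Num.truncn T)].
Proof.
move=> m Lm /=; apply: mem_bounded_indices.
  exact: approx_indices_nzpos_le.
exact: approx_indices_prod_le.
Qed.

Lemma finite_approx_indices : finite_set (@approx_indices R d c lambda K).
Proof. exact: sub_finite_set approx_indices_sub (finite_seq _). Qed.

Lemma degrees_of_freedom_le :
  (degrees_of_freedom (@approx_indices R d c lambda K))%:R <=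
    #|{set 'I_d}|%:R * (T * (1 + ln (1 + T)) ^+ u.-1).
Proof.
have T0 : 0 <= T by rewrite divr_ge0 ?ltW.
(* For [T < 1] the enumeration still lists the zero index, which would break the bound; but then the
   index set is empty, because a product of successors is at least [1]. *)
have [X0|X0] := posnP (Num.truncn T).
  rewrite /degrees_of_freedom (_ : approx_indices _ _ _ = set0).
    rewrite fset_set0 cardfs0 mulr_ge0 ?ler0n// mulr_ge0// exprn_ge0//.
    by rewrite addr_ge0// ln_ge0// lerDl.
  apply/seteqP; split => // m /approx_indices_prod_le.
  by rewrite X0 leqNgt prodn_gt0.
apply: (@le_trans _ _ (size (bounded_indices d u (Num.truncn T)))%:R).
  rewrite ler_nat uniq_leq_size// => m.
  by rewrite in_fset_set ?inE; [exact: approx_indices_sub|exact: finite_approx_indices].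
by apply: size_bounded_indices => //; rewrite truncn_le.
Qed.

Lemma hermite_hdmr_truncated (a : Rd R d) (f : Rd R d -> R) :
  truncated_HDMR u (approx_indices c lambda K)
    (fun m x => alpha lambda a f m * hermite lambda a m x)
    (hermite_hdmr c lambda a f K).
Proof.
have finL := finite_approx_indices; split => //.
- by move=> m _ x y xy; congr (_ * _); exact: hermite_depends_only_on.
- by move=> m; exact: approx_indices_nzpos_le.
move=> x; rewrite /hermite_hdmr.
(* The levels [k] are first merged into one sum over all indices, which is then split by [nzpos]. *)
transitivity (\sum_(m \in approx_indices c lambda K)
    alpha lambda a f m * hermite lambda a m x).
  rewrite [RHS](@fsum_fibers _ _ _ _ (fun m => Num.truncn (P m))
    (index_iota 1 K.+1))//; first last.
  - by move=> m [k kK /Gamma_truncn ->]; rewrite mem_index_iota ltnS.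
  - exact: iota_uniq.
  apply: eq_big_seq => k; rewrite mem_index_iota ltnS => kK.
  by rewrite approx_indices_Gamma.
rewrite (@fsum_fibers _ _ _ _ (@nzpos d)
  [seq A : {set 'I_d} <- index_enum {set 'I_d} | (#|A| <= u)%N])//.
- by rewrite big_filter.
- by rewrite filter_uniq// index_enum_uniq.
- by move=> m Lm; rewrite mem_filter mem_index_enum andbT approx_indices_nzpos_le.
Qed.

End approximation.

Theorem mainTheorem3 (R : realType) (d : nat) (d_gt0 : (0 < d)%N) :
  exists C : R, 0 < C /\
    forall (K u : nat) (lambda c : R) (a : Rd R d) (f : Rd R d -> R),
      (1 <= K)%N -> 0 < lambda -> 1 <= c ->
      f \in Lfun (lebesgue_Rd R d) 2%:E ->
      (\int[lebesgue_Rd R d]_x (`|f x| ^+ 2 * weight lambda a x)%:E < +oo)%E ->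
      (1 <= u <= d)%N ->
      (1 + c) ^+ u.+1 > (K.+1)%:R / (2 * lambda ^+ 2) ^+ d ->
      truncated_HDMR u (approx_indices c lambda K)
        (fun m x => alpha lambda a f m * hermite lambda a m x)
        (hermite_hdmr c lambda a f K)
      /\
      (degrees_of_freedom (@approx_indices R d c lambda K))%:R <=
        C * ((K.+1)%:R / (2 * lambda ^+ 2) ^+ d *
             (1 + ln (1 + (K.+1)%:R / (2 * lambda ^+ 2) ^+ d)) ^+ u.-1).
Proof.
(* The constant is [2 ^ d], the number of possible position sets; it depends on [d] alone. *)
exists #|{set 'I_d}|%:R; split.
  by rewrite ltr0n; apply/card_gt0P; exists finset.set0.
move=> K u lambda c a f _ lambda_gt0 c_ge1 _ _ /andP[u_gt0 _] T_lt; split.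
  exact: hermite_hdmr_truncated.
exact: degrees_of_freedom_le.
Qed.
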